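(* For $a>1$ and $\sigma>0$ let \[ R_a(\sigma):=\max_{x\in(0,1)}\frac{\beta_{a,a}(x)}{\phi_{1/2,\sigma}(x)}. \] Fix a number $\delta\ge -1$ and let $\sigma(a):=(8(a+\delta))^{-1/2}$ for $a>1$. Then $a\mapsto\log R_a(\sigma(a))$ is strictly decreasing in $a>1$, and \[ \log R_a(\sigma(a))\ =\ \frac{\delta(\delta+1)+3/4}{2a}+O(a^{-2})\quad\text{as } a\to\infty. \]
   Context: $\beta_{a,a}(x)=\dfrac{\Gamma(2a)}{\Gamma(a)^2}\,x^{a-1}(1-x)^{a-1}$, $x\in(0,1)$, is the density of the symmetric beta distribution $\mathrm{Beta}(a,a)$, and $\phi_{1/2,\sigma}$ is the density of the Gaussian distribution $\mathcal{N}(1/2,\sigma^2)$ with mean $1/2$ and standard deviation $\sigma$. *)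

(* Defs.v *)
From HB Require Import structures.
From mathcomp Require Import all_boot all_order all_algebra.
From mathcomp Require Import all_classical all_reals all_analysis.

Set Implicit Arguments.
Unset Strict Implicit.
Unset Printing Implicit Defensive.

Import Order.TTheory GRing.Theory Num.Theory.
Import numFieldNormedType.Exports.

Local Open Scope classical_set_scope.
Local Open Scope ring_scope.

(* Lets the Landau notations be used with the filter [+oo]. *)
Canonical pinfty_filter_on (R : realType) : filter_on R :=
  FilterType (pinfty_nbhs R) _.

Definition Gamma {R : realType} (s : R) : R :=
  \int[@lebesgue_measure R]_(t in `]0, +oo[) (t `^ (s - 1) * expR (- t)).

(* The library's [beta_pdf] only covers parameters in [nat].  No indicator of
   the support is included: this is meant to be evaluated on ]0, 1[ only. *)
Definition sym_beta_pdf {R : realType} (a x : R) : R :=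
  Gamma (2 * a) / Gamma a ^+ 2 * x `^ (a - 1) * (1 - x) `^ (a - 1).

(* [normal_pdf m s] has mean [m] and standard deviation (not variance) [s]. *)
Definition beta_normal_ratio {R : realType} (a sigma x : R) : R :=
  sym_beta_pdf a x / normal_pdf 2^-1 sigma x.

Definition is_max {R : realType} (A : set R) (m : R) : Prop :=
  A m /\ ubound A m.

(* A supremum, so as to be total in [a] and [sigma]; it is attained, i.e. it
   satisfies [is_max], when 1 < a and 0 < sigma. *)
Definition max_ratio {R : realType} (a sigma : R) : R :=
  sup [set beta_normal_ratio a sigma x | x in `]0, 1[].

Definition sigma_of {R : realType} (delta a : R) : R :=
  (8 * (a + delta)) `^ (- 2^-1).

Definition log_max_ratio {R : realType} (delta a : R) : R :=
  ln (max_ratio a (sigma_of delta a)).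

(* Main.v *)
Require Import Defs.
From HB Require Import structures.
From mathcomp Require Import all_boot all_order all_algebra.
From mathcomp Require Import all_classical all_reals all_analysis.
From mathcomp Require Import measurable_realfun.
From mathcomp Require Import ring lra.

Import Order.TTheory GRing.Theory Num.Theory.
Import numFieldNormedType.Exports.

Local Open Scope classical_set_scope.
Local Open Scope ring_scope.

(** The ratio of the two densities depends on x only through y = x (1 - x), and
    its logarithm is a concave function of y. Its maximum is therefore attained
    at the critical point m, cut off at 1/4 ([is_max_beta_normal]). For the
    given standard deviation the critical point is (a - 1) / (4 (a + d)), at
    most 1/4 because d >= -1, and the logarithm of the maximum involves
    ln Gamma (2a) - 2 ln Gamma (a). Legendre's duplication formula
    ([ln_Gamma_duplication]) turns it into the closed form ([log_max_ratioE])

      F a = ln Gamma (a + 1/2) - ln Gamma (a) + (a - 1) ln (a - 1)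
            - (a - 1/2) ln (a + d) + 1 + d.

    Both claims about F are proved by telescoping along unit steps, so that of
    Gamma only the recursion [GammaS] and the bound
    Gamma (x + th) <= x^th Gamma x for 0 <= th <= 1 ([Gamma_le]) are used; no
    derivative of Gamma occurs. The same two facts, with the value at 3/2,
    prove the duplication formula: the logarithm of the quotient of its two
    sides is periodic, antitone, and 0 at 1.

    Asymptotics. The increment ln Gamma (a + 1/2) - ln Gamma (a) differs from
    ln (a) / 2 by a function tending to 0. Its unit-step differences are
    elementary, and expanding them shows that it is - 1 / (8a) up to an error
    of order a^-2. The rest of F is expanded directly ([log_max_asymptotics]).

    Monotonicity. The drop F a - F (a + 1) is elementary, and its derivative is
    negative ([log_max_drop'_lt0]). Hence for a < b the sequence
    F (a + n) - F (b + n) is strictly decreasing; it tends to 0 by the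
    asymptotics, so F a > F b ([log_max_decreasing]). *)

(** * Euler's integral: convergence, recursion, special values *)

Section euler_integral.
Set Implicit Arguments.
Unset Strict Implicit.
Context {R : realType}.
Implicit Types (a c s t x K : R).
Local Notation mu := (@lebesgue_measure R).

(** Packages the fundamental theorem of calculus on the half-line with the
    integrability of the derivative, since every integral below is obtained
    from an explicit primitive and is then combined linearly with others. *)
Lemma FTC_half_line (f F : R -> R) (l : R) :
  (forall t, 0 <= t -> 0 <= f t) ->
  {within `[0, +oo[, continuous f} ->
  F t @[t --> +oo] --> l -> F t @[t --> 0^'+] --> F 0 ->
  (forall t, 0 < t -> is_derive t 1 F (f t)) ->
  mu.-integrable `]0, +oo[ (EFin \o f) /\
  \int[mu]_(t in `]0, +oo[) f t = l - F 0.
Proof.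
move=> f0 cf Fl F0 dF.
have I : (\int[mu]_(t in `[0%R, +oo[) (f t)%:E = l%:E - (F 0%R)%:E)%E.
  apply: ge0_continuous_FTC2y => //; first by move=> t /dF [].
  move=> t; rewrite in_itv/= andbT => /dF dFt.
  by rewrite derive1E derive_val.
have mf : measurable_fun `](0 : R), +oo[ f.
  apply: open_continuous_measurable_fun => //.
  by move: cf => /continuous_within_itvcyP[/in_continuous_mksetP cf _].
have J : (\int[mu]_(t in `]0%R, +oo[) (f t)%:E = l%:E - (F 0%R)%:E)%E.
  by rewrite integral_itv_obnd_cbnd//; exact/measurable_EFinP.
split; last by rewrite /Rintegral J.
apply/integrableP; split; first exact/measurable_EFinP.
under eq_integral => t.
  rewrite inE/= in_itv/= andbT => t0.
  rewrite ger0_norm; last by apply: f0; apply: ltW.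
  over.
by rewrite J -EFinB ltry.
Qed.

Lemma continuous_expRZ c : continuous (fun t : R => expR (c * t)).
Proof.
move=> t; apply: continuous_comp; last exact: continuous_expR.
exact: mulrl_continuous.
Qed.

Lemma cvgr_expRZ c : c < 0 -> expR (c * t) @[t --> +oo] --> 0.
Proof.
move=> c0.
have -> : (fun t => expR (c * t)) = (fun t => expR (- t)) \o (fun t => - c * t).
  by apply/funext => t /=; rewrite mulNr opprK.
apply: (cvg_comp _ _ _ (@cvgr_expR R)).
by apply: gt0_cvgMry; [rewrite oppr_gt0|exact: cvg_id].
Qed.

Lemma continuous_powR_ge0 c : 0 <= c ->
  {within `[0, +oo[, continuous (fun t : R => t `^ c)}.
Proof.
move=> c0; apply/continuous_within_itvcyP; split.
  move=> t; rewrite in_itv/= andbT => t0.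
  apply: differentiable_continuous; apply/derivable1_diffP.
  by apply: derivable_powR; rewrite in_itv/= t0.
move: c0; rewrite le_eqVlt => /predU1P[<-|c0].
  under eq_fun do rewrite powRr0.
  by rewrite powRr0; exact: cvg_cst.
by rewrite powR0 ?gt_eqF//; exact: powR_cvg0.
Qed.

(** With m = 2 (c + 1), the bound ln u <= u at u = (1 + t) / m gives
    c ln (1 + t) <= c ln m + (1 + t) / 2. Using 1 + t instead of t keeps the
    logarithm away from 0, so that t = 0 and c = 0 are not special. *)
Lemma powR_le_expR c : 0 <= c ->
  exists2 K, 0 < K & forall t, 0 <= t -> t `^ c <= K * expR (t / 2).
Proof.
move=> c0; pose m := 2 * (c + 1).
have m0 : 0 < m by rewrite /m; lra.
exists (expR (c * ln m + 2^-1)); first exact: expR_gt0.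
move=> t t0; rewrite -expRD.
have t1 : 0 < 1 + t by lra.
apply: (@le_trans _ _ ((1 + t) `^ c)).
  by apply: ge0_ler_powR => //; rewrite ?nnegrE; lra.
rewrite /powR gt_eqF// ler_expR.
have : ln ((1 + t) / m) <= (1 + t) / m.
  by apply/ltW/ln_sublinear; rewrite divr_gt0.
rewrite ln_div ?posrE// => lnle.
have : c * (ln (1 + t) - ln m) <= c * ((1 + t) / m) by rewrite ler_wpM2l.
have : c * ((1 + t) / m) <= (1 + t) / 2.
  rewrite mulrCA ler_pM2l// ler_pdivrMr// /m; lra.
lra.
Qed.

Lemma within_continuousD (A : set R) (f g : R -> R) :
  {within A, continuous f} -> {within A, continuous g} ->
  {within A, continuous (fun t => f t + g t)}.
Proof.
move=> cf cg t.
by apply: (@continuousD _ R (subspace A)); [exact: cf|exact: cg].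
Qed.

Lemma within_continuousM (A : set R) (f g : R -> R) :
  {within A, continuous f} -> {within A, continuous g} ->
  {within A, continuous (fun t => f t * g t)}.
Proof.
move=> cf cg t.
by apply: (@continuousM _ (subspace A)); [exact: cf|exact: cg].
Qed.

Lemma integrable_scale (c : R) (g : R -> R) :
  mu.-integrable `]0, +oo[ (EFin \o g) ->
  mu.-integrable `]0, +oo[ (EFin \o (fun t => c * g t)).
Proof.
by move=> ig; have := @integrableZl _ _ _ mu `]0, +oo[ _ c _ ig; exact.
Qed.

Lemma within_continuous_expRN :
  {within `[0, +oo[, continuous (fun t : R => expR (- t))}.
Proof.
apply: continuous_subspaceT => t.
by apply: continuous_comp; [exact: continuousN|exact: continuous_expR].
Qed.

Lemma integral_expR_half :
  mu.-integrable `]0, +oo[ (EFin \o (fun t => expR (- 2^-1 * t))) /\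
  \int[mu]_(t in `]0, +oo[) expR (- 2^-1 * t) = 2.
Proof.
have ce := @continuous_expRZ (- 2^-1).
have [] := @FTC_half_line (fun t => expR (- 2^-1 * t))
   (fun t => - 2 * expR (- 2^-1 * t)) 0.
- by move=> t _; exact: expR_ge0.
- exact: continuous_subspaceT.
- rewrite -[X in _ --> X](mulr0 (- 2)).
  by apply: cvgM; [exact: cvg_cst|apply: cvgr_expRZ; rewrite oppr_lt0 invr_gt0].
- apply: cvg_at_right_filter; apply: cvgM; [exact: cvg_cst|exact: ce].
- move=> t _; apply: is_derive_eq.
  rewrite /GRing.scale/=; lra.
- by rewrite mulr0 expR0 => i ->; split => //; lra.
Qed.

(** The common majorant that makes Euler's integral converge. *)
Lemma powR_expRN_le c : 0 <= c -> exists2 K, 0 < K &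
  forall t, 0 <= t -> t `^ c * expR (- t) <= K * expR (- 2^-1 * t).
Proof.
move=> /powR_le_expR[K K0 tK]; exists K => // t t0.
have -> : expR (- 2^-1 * t) = expR (t / 2) * expR (- t).
  by rewrite -expRD; congr expR; lra.
by rewrite mulrA ler_pM2r ?expR_gt0//; exact: tK.
Qed.

Lemma integrable_Gamma a : 1 <= a ->
  mu.-integrable `]0, +oo[ (EFin \o (fun t => t `^ (a - 1) * expR (- t))).
Proof.
move=> a1; have /powR_expRN_le[K K0 tK] : 0 <= a - 1 by lra.
have [ie _] := integral_expR_half.
have iKe := integrable_scale K ie.
apply: le_integrable iKe => //.
- apply/measurable_EFinP; apply: measurable_funTS; apply: measurable_funM.
    exact: measurable_powR.
  by apply: measurableT_comp => //; exact: measurableT_comp.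
- move=> t; rewrite /= in_itv/= andbT => t0.
  rewrite lee_fin !ger0_norm ?tK ?(ltW t0)//.
    by rewrite mulr_ge0 ?expR_ge0 ?(ltW K0).
  by rewrite mulr_ge0 ?expR_ge0 ?powR_ge0.
Qed.

Lemma cvg_powR_expRN c : 0 <= c -> t `^ c * expR (- t) @[t --> +oo] --> 0.
Proof.
move=> /powR_expRN_le[K K0 tK].
apply: (@squeeze_cvgr _ _ _ _ (fun=> 0) (fun t => K * expR (- 2^-1 * t))).
- near=> t; rewrite mulr_ge0 ?powR_ge0 ?expR_ge0//= tK//.
- exact: cvg_cst.
- rewrite -[X in _ --> X](mulr0 K).
  by apply: cvgM; [exact: cvg_cst|apply: cvgr_expRZ; rewrite oppr_lt0 invr_gt0].
Unshelve. all: by end_near. Qed.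

(** The primitive - t^a e^-t of t^a e^-t - a t^(a-1) e^-t gives the recursion.
    As this integrand changes sign, a multiple of e^(-t/2) large enough to make
    it nonnegative is added and its known integral subtracted afterwards. *)
Lemma GammaS a : 1 <= a -> Gamma (a + 1) = a * Gamma a.
Proof.
move=> a1; have a0 : 0 < a by lra.
have ia := integrable_Gamma a1.
have ia1 : mu.-integrable `]0, +oo[ (EFin \o (fun t => t `^ a * expR (- t))).
  by have := @integrable_Gamma (a + 1); rewrite addrK; apply; lra.
have [ie ve] := integral_expR_half.
have [K K0 tK] : exists2 K, 0 < K &
    forall t, 0 <= t -> t `^ (a - 1) * expR (- t) <= K * expR (- 2^-1 * t).
  by apply: powR_expRN_le; lra.
pose f t := t `^ a * expR (- t) + (- a) * (t `^ (a - 1) * expR (- t)) +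
  a * K * expR (- 2^-1 * t).
pose F t := (- 1) * (t `^ a * expR (- t)) + (- (2 * a * K)) * expR (- 2^-1 * t).
have cE := within_continuous_expRN.
have cE2 : {within `[0, +oo[, continuous (fun t : R => expR (- 2^-1 * t))}.
  by apply: continuous_subspaceT; exact: continuous_expRZ.
have cst u : {within `[0, +oo[, continuous (fun _ : R => u : R)}.
  by apply: continuous_subspaceT => ?; exact: cvg_cst.
have cp c : 0 <= c ->
    {within `[0, +oo[, continuous (fun t : R => t `^ c * expR (- t))}.
  by move=> c0; apply: within_continuousM => //; exact: continuous_powR_ge0.
have [] := @FTC_half_line f F 0.
- move=> t t0; rewrite /f.
  have : a * (t `^ (a - 1) * expR (- t)) <= a * (K * expR (- 2^-1 * t)).
    by rewrite ler_pM2l//; exact: tK.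
  have : 0 <= t `^ a * expR (- t) by rewrite mulr_ge0 ?powR_ge0 ?expR_ge0.
  lra.
- apply: within_continuousD; last exact: within_continuousM.
  apply: within_continuousD; first by apply: cp; lra.
  apply: within_continuousM => //; apply: cp; lra.
- rewrite -[X in _ --> X]addr0 -[X in X + _](mulr0 (- 1)).
  rewrite -[X in _ + X](mulr0 (- (2 * a * K))).
  apply: cvgD.
    by apply: cvgM; [exact: cvg_cst|apply: cvg_powR_expRN; lra].
  by apply: cvgM; [exact: cvg_cst|apply: cvgr_expRZ; rewrite oppr_lt0 invr_gt0].
- have : {within `[0, +oo[, continuous F}.
    apply: within_continuousD; apply: within_continuousM => //.
    by apply: cp; lra.
  by case/continuous_within_itvcyP.
- move=> t t0; have := is_derive1_powR a t0 => dp.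
  rewrite /F /f; apply: is_derive_eq.
  rewrite /GRing.scale/=; lra.
- move=> _; rewrite /F powR0 ?gt_eqF// mul0r !mulr0 expR0 => I.
have sub : \int[mu]_(t in `]0, +oo[) (t `^ a * expR (- t)) = Gamma (a + 1).
  by rewrite /Gamma addrK.
have iaa := integrable_scale (- a) ia.
have iaK := integrable_scale (a * K) ie.
have := @integrableD _ _ _ mu `]0, +oo[ _ _ _ ia1 iaa.
move=> /(_ (measurable_itv _)) iD.
move: I; rewrite RintegralD//= RintegralD// RintegralZl// RintegralZl//.
rewrite sub ve -/(Gamma a); lra.
Qed.

Lemma Gamma1 : Gamma (1 : R) = 1.
Proof.
have ce := @continuous_expRZ (- 1).
have -> : Gamma (1 : R) = \int[mu]_(t in `]0, +oo[) expR (- 1 * t).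
  by apply: eq_Rintegral => t _; rewrite subrr powRr0 mul1r mulN1r.
have [] := @FTC_half_line (fun t => expR (- 1 * t))
  (fun t => - 1 * expR (- 1 * t)) 0.
- by move=> t _; exact: expR_ge0.
- exact: continuous_subspaceT.
- rewrite -[X in _ --> X](mulr0 (- 1)).
  by apply: cvgM; [exact: cvg_cst|apply: cvgr_expRZ; rewrite oppr_lt0].
- apply: cvg_at_right_filter; apply: cvgM; [exact: cvg_cst|exact: ce].
- move=> t _; apply: is_derive_eq.
  by rewrite /GRing.scale/=; lra.
- by move=> _ ->; rewrite mulr0 expR0; lra.
Qed.

Import gauss_integral_proof.

Lemma cvg_integral0_gauss :
  @integral0_gauss R x @[x --> +oo] --> Num.sqrt pi / 2.
Proof.
have : Num.sqrt (@integral0_gauss R x ^+ 2) @[x --> +oo] --> Num.sqrt (pi / 4).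
  apply: continuous_cvg; first exact: sqrt_continuous.
  exact: cvg_integral0_gauss_sqr.
rewrite sqrtrM ?pi_ge0// sqrtrV// (_ : 4 = 2 ^+ 2);
  last by rewrite expr2 -natrM.
rewrite sqrtr_sqr ger0_norm//.
under eq_cvg do rewrite sqrtr_sqr ger0_norm ?integral0_gauss_ge0//.
exact.
Qed.

Lemma is_derive_integral0_gauss x : 0 < x ->
  is_derive x 1 (@integral0_gauss R) (expR (- x ^+ 2)).
Proof.
move=> x0.
have [] := @continuous_FTC1_closed R gauss_fun 0 x (x + 1).
- by rewrite ltrDl.
- apply: continuous_compact_integrable => //; first exact: segment_compact.
  by apply: continuous_subspaceT; exact: continuous_gauss_fun.
- exact: x0.
- exact: continuous_gauss_fun.
- move=> d e; apply: DeriveDef; first exact: d.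
  by rewrite -derive1E; exact: e.
Qed.

Lemma cvg_integral0_gauss0 :
  @integral0_gauss R x @[x --> 0^'+] --> @integral0_gauss R 0.
Proof.
have : {within `[0, 1], continuous @integral0_gauss R}.
  apply: parameterized_integral_continuous => //.
  apply: continuous_compact_integrable => //; first exact: segment_compact.
  by apply: continuous_subspaceT; exact: continuous_gauss_fun.
by case/continuous_within_itvP.
Qed.

(** The value at 3/2 is where pi enters: sqrt t e^-t has the primitive
    - sqrt t e^-t + I (sqrt t), where I is the integral of e^(-s^2) from 0. *)
Lemma Gamma_3half : Gamma (3 / 2 : R) = Num.sqrt pi / 2.
Proof.
pose h : R := 2^-1.
have h0 : 0 < h by rewrite invr_gt0.
pose F t := (- 1) * (t `^ h * expR (- t)) + integral0_gauss (t `^ h).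
have cE := within_continuous_expRN.
have cF : {within `[0, +oo[, continuous (fun t : R => t `^ h * expR (- t))}.
  by apply: within_continuousM => //; apply: continuous_powR_ge0; exact: ltW.
have pow2 t : 0 <= t -> (t `^ h) ^+ 2 = t.
  by move=> t0; rewrite -powR_mulrn ?powR_ge0// -powRrM mulVf// powRr1.
have -> : Gamma (3 / 2 : R) = \int[mu]_(t in `]0, +oo[) (t `^ h * expR (- t)).
  by apply: eq_Rintegral => t _; congr (_ `^ _ * _); rewrite /h; lra.
have [] := @FTC_half_line (fun t => t `^ h * expR (- t)) F (Num.sqrt pi / 2).
- by move=> t _; rewrite mulr_ge0 ?powR_ge0 ?expR_ge0.
- exact: cF.
- rewrite -[X in _ --> X]add0r -[X in X + _](mulr0 (- 1)).
  apply: cvgD.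
    by apply: cvgM; [exact: cvg_cst|apply: cvg_powR_expRN; exact: ltW].
  apply: cvg_comp cvg_integral0_gauss.
  apply/cvgryPge => A; near=> t.
  have [A0|A0] := leP A 0; first by rewrite (le_trans A0)// powR_ge0.
  rewrite -(@ler_pXn2r _ 2) ?nnegrE ?powR_ge0 ?(ltW A0)// pow2.
    by near: t; apply: nbhs_pinfty_ge; exact: num_real.
  by near: t; apply: nbhs_pinfty_ge; exact: num_real.
- have -> : F 0 = (- 1) * (0 `^ h * expR (- 0)) + integral0_gauss 0.
    by rewrite /F powR0// gt_eqF.
  apply: cvgD.
    apply: cvgM; first exact: cvg_cst.
    by move/continuous_within_itvcyP : cF => [].
  apply: cvg_comp cvg_integral0_gauss0.
  move=> A [/= d d0 dA]; near=> t; apply: dA => /=.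
    near: t; have /cvgrPdist_lt := @powR_cvg0 R h h0.
    by apply.
  by rewrite powR_gt0.
- move=> t t0; have dp := is_derive1_powR h t0.
  have dI : is_derive (t `^ h) 1 (@integral0_gauss R) (expR (- (t `^ h) ^+ 2)).
    by apply: is_derive_integral0_gauss; rewrite powR_gt0.
  have dc : is_derive t 1 (fun t => integral0_gauss (t `^ h)) _ :=
    @is_derive1_comp _ _ (fun t => t `^ h) _ _ _ dI dp.
  rewrite /F; apply: is_derive_eq.
  rewrite pow2 ?ltW// /GRing.scale/=; lra.
- move=> _ ->; rewrite /F powR0 ?gt_eqF// mul0r mulr0 add0r /integral0_gauss.
  by rewrite set_itv1 Rintegral_set1 subr0.
Unshelve. all: by end_near.
Qed.

(** * Log-convexity of Gamma *)

(** The concave function t^th lies below its tangent at t = x. With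
    t = x e^s this is the weighted arithmetic-geometric mean inequality
    e^(th s) <= 1 - th + th e^s, which follows from 1 + u <= e^u at
    u = - th s and u = (1 - th) s. *)
Lemma powR_le_affine t x th : 0 < t -> 0 < x -> 0 <= th <= 1 ->
  t `^ th <= x `^ th * (1 - th + th / x * t).
Proof.
move=> t0 x0 /andP[th0 th1].
pose s := ln t - ln x.
have -> : t `^ th = x `^ th * expR (th * s).
  by rewrite /powR !gt_eqF// -expRD; congr expR; rewrite /s; lra.
have tE : t = x * expR s.
  by rewrite /s expRB !lnK ?posrE//; field; rewrite gt_eqF.
rewrite ler_pM2l ?powR_gt0//.
have -> : th / x * t = th * expR s by rewrite tE; field; rewrite gt_eqF.
set y := expR (th * s).
have y0 : 0 < y by exact: expR_gt0.
have e1 : 1 = y * expR (- (th * s)) by rewrite -expRD subrr expR0.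
have e2 : expR s = y * expR ((1 - th) * s) by rewrite -expRD; congr expR; lra.
have l1 : y * (1 - th * s) <= 1.
  by rewrite [leRHS]e1 ler_pM2l// expR_ge1Dx.
have l2 : y * (1 + (1 - th) * s) <= expR s.
  by rewrite [leRHS]e2 ler_pM2l// expR_ge1Dx.
have : (1 - th) * (y * (1 - th * s)) <= (1 - th) * 1.
  by rewrite ler_wpM2l// subr_ge0.
have : th * (y * (1 + (1 - th) * s)) <= th * expR s.
  by rewrite ler_wpM2l.
lra.
Qed.

(** Integrating the tangent bound at t = x against t^(x-1) e^-t: as
    Gamma (x + 1) = x Gamma x, the affine factor integrates to Gamma x. This
    is log-convexity in the form of Gautschi's inequality. *)
Lemma Gamma_le x th : 1 <= x -> 0 <= th <= 1 ->
  Gamma (x + th) <= x `^ th * Gamma x.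
Proof.
move=> x1 th01; have /andP[th0 th1] := th01.
have x0 : 0 < x by lra.
have ix := integrable_Gamma x1.
have ix1 : mu.-integrable `]0, +oo[ (EFin \o (fun t => t `^ x * expR (- t))).
  by have := @integrable_Gamma (x + 1); rewrite addrK; apply; lra.
have ixt : mu.-integrable `]0, +oo[
    (EFin \o (fun t => t `^ (x + th - 1) * expR (- t))).
  by apply: integrable_Gamma; lra.
have i1 := integrable_scale (x `^ th * (1 - th)) ix.
have i2 := integrable_scale (x `^ th * (th / x)) ix1.
have := @integrableD _ _ _ mu `]0, +oo[ _ _ _ i1 i2.
move=> /(_ (measurable_itv _)) iD.
apply: le_trans (le_Rintegral _ ixt iD _) _ => //.
  move=> t; rewrite /= in_itv/= andbT => t0.
  have -> : t `^ (x + th - 1) = t `^ (x - 1) * t `^ th.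
    rewrite -powRD; last by rewrite (gt_eqF t0) implybT.
    by congr powR; lra.
  have -> : t `^ x = t `^ (x - 1) * t by rewrite mulrC mulr_powRB1// ltW.
  have : t `^ (x - 1) * expR (- t) * t `^ th <=
      t `^ (x - 1) * expR (- t) * (x `^ th * (1 - th + th / x * t)).
    rewrite ler_wpM2l ?mulr_ge0 ?powR_ge0 ?expR_ge0//.
    exact: powR_le_affine.
  lra.
rewrite RintegralD// RintegralZl// RintegralZl//.
have -> : \int[mu]_(t in `]0, +oo[) (t `^ x * expR (- t)) = x * Gamma x.
  by rewrite -GammaS// /Gamma addrK.
rewrite -/(Gamma x) le_eqVlt; apply/orP; left; apply/eqP; field.
by rewrite gt_eqF.
Qed.

(** On [1, 2] the bound Gamma 2 <= y^(2-y) Gamma y forces positivity, and the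
    recursion propagates it. *)
Lemma Gamma_gt0 x : 1 <= x -> 0 < Gamma x.
Proof.
have step n : forall y : R, 1 <= y <= 2 -> 0 < Gamma (y + n%:R).
  elim: n => [|n ih] y y12; last first.
    rewrite -natr1 addrA GammaS; last by rewrite ler_wpDr//; case/andP: y12.
    by rewrite mulr_gt0 ?ih// ltr_wpDr//; case/andP: y12; lra.
  have : Gamma (y + (2 - y)) <= y `^ (2 - y) * Gamma y.
    by apply: Gamma_le; case/andP: y12; lra.
  rewrite (_ : y + (2 - y) = 1 + 1); last lra.
  rewrite GammaS// Gamma1 addr0 => le1.
  have yp : 0 < y by case/andP: y12; lra.
  rewrite -(pmulr_rgt0 _ (powR_gt0 (2 - y) yp)).
  by apply: lt_le_trans le1; lra.
move=> x1; have x10 : 0 <= x - 1 by lra.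
have /andP[ge lt] := truncn_itv x10.
set n := Num.truncn (x - 1) in ge lt.
have -> : x = (x - n%:R) + n%:R by lra.
apply: step; rewrite -natr1 in lt; lra.
Qed.

End euler_integral.

(** Sealed, so that comparing two values never unfolds Euler's integral. *)
HB.lock Definition ln_Gamma {R : realType} (x : R) : R := ln (Gamma x).

Section ln_Gamma.
Set Implicit Arguments.
Unset Strict Implicit.
Context {R : realType}.
Implicit Types (x th : R).

Lemma ln_GammaE x : ln_Gamma x = ln (Gamma x).
Proof. by rewrite ln_Gamma.unlock. Qed.

Lemma ln_GammaS x : 1 <= x -> ln_Gamma (x + 1) = ln x + ln_Gamma x.
Proof.
by move=> x1; rewrite !ln_GammaE GammaS// lnM// posrE ?Gamma_gt0//; lra.
Qed.

Lemma ln_Gamma_le x th : 1 <= x -> 0 <= th <= 1 ->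
  ln_Gamma (x + th) <= th * ln x + ln_Gamma x.
Proof.
move=> x1 th01; have x0 : 0 < x by lra.
have G0 : 0 < Gamma (x + th) by apply: Gamma_gt0; lra.
have Gx0 := Gamma_gt0 x1; have p0 := powR_gt0 th x0.
rewrite !ln_GammaE -ln_powR -lnM ?posrE// ler_ln ?posrE ?mulr_gt0//.
exact: Gamma_le.
Qed.

(** The upper bound for the complementary step, from x + th to x + 1. *)
Lemma ln_Gamma_ge x th : 1 <= x -> 0 <= th <= 1 ->
  ln_Gamma x + ln x - (1 - th) * ln (x + th) <= ln_Gamma (x + th).
Proof.
move=> x1 th01.
have := @ln_Gamma_le (x + th) (1 - th).
have -> : x + th + (1 - th) = x + 1 by lra.
rewrite ln_GammaS// => H.
have : 1 <= x + th by lra.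
by move=> /H {}H; have := H ltac:(lra); lra.
Qed.

End ln_Gamma.

(** * Legendre's duplication formula *)

Section duplication.
Set Implicit Arguments.
Unset Strict Implicit.
Context {R : realType}.
Implicit Types (a x y h th : R).

Lemma ln_le_sub1 x : 0 < x -> ln x <= x - 1.
Proof.
move=> x0; have := @le_ln1Dx R (x - 1); rewrite (addrC 1) subrK; apply.
by rewrite ltrBrDr addNr.
Qed.

Lemma lnD_le x h : 0 < x -> 0 < x + h -> ln (x + h) <= ln x + h / x.
Proof.
move=> x0 xh0; have := ln_le_sub1 (divr_gt0 xh0 x0).
rewrite ln_div ?posrE// mulrDl divff ?gt_eqF//; lra.
Qed.

(** Passage to the limit along x, x + 1, x + 2, and so on. *)
Lemma le_of_le_addV (u v c x : R) :
  (forall n : nat, u <= v + c / (x + n%:R)) -> u <= v.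
Proof.
move=> H; apply/ler_addgt0Pr => e e0.
pose n := Num.bound (`|c| / e + `|x|).
have xn : `|c| / e < x + n%:R.
  have : `|c| / e + `|x| < n%:R.
    by apply: archi_boundP; rewrite addr_ge0// divr_ge0// ltW.
  by have := ler_norm (- x); rewrite normrN; lra.
have xn0 : 0 < x + n%:R by apply: le_lt_trans xn; rewrite divr_ge0// ltW.
apply: le_trans (H n) _; rewrite lerD2l.
rewrite ler_pdivrMr//; apply: le_trans (ler_norm c) _.
by move: xn; rewrite ltr_pdivrMr// => /ltW; rewrite mulrC.
Qed.

(** The logarithm of the quotient of the two sides of the duplication
    formula. *)
Let defect a := ln_Gamma (2 * a) - ln_Gamma a - ln_Gamma (a + 2^-1) -
  (2 * a - 1) * ln 2 + 2^-1 * ln pi.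

Let defect_periodic a (n : nat) : 1 <= a -> defect (a + n%:R) = defect a.
Proof.
have step b : 1 <= b -> defect (b + 1) = defect b.
  move=> b1; rewrite /defect.
  have -> : 2 * (b + 1) = (2 * b + 1) + 1 by lra.
  have -> : b + 1 + 2^-1 = (b + 2^-1) + 1 by lra.
  rewrite (@ln_GammaS _ (2 * b + 1)) ?(@ln_GammaS _ (2 * b)) ?(@ln_GammaS _ b)
    ?(@ln_GammaS _ (b + 2^-1)); try lra.
  have -> : ln (2 * b + 1) = ln 2 + ln (b + 2^-1).
    by rewrite -lnM ?posrE; [congr ln| |]; lra.
  rewrite lnM ?posrE; lra.
move=> a1; elim: n => [|n ih]; first by rewrite addr0.
by rewrite -natr1 addrA step// ler_wpDr.
Qed.

(** Bounding Gamma (2a + 2 th) from above and the other two factors from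
    below, all terms of order ln a cancel. *)
Let defect_shift_le a th : 1 <= a -> 0 <= th <= 2^-1 ->
  defect (a + th) <= defect a + 2 / a.
Proof.
move=> a1 /andP[th0 th1]; rewrite /defect.
have a0 : 0 < a by lra.
have := @ln_Gamma_le R (2 * a) (2 * th) ltac:(lra) ltac:(lra).
have := @ln_Gamma_ge R a th ltac:(lra) ltac:(lra).
have := @ln_Gamma_ge R (a + 2^-1) th ltac:(lra) ltac:(lra).
have -> : 2 * a + 2 * th = 2 * (a + th) by lra.
have -> : a + 2^-1 + th = a + th + 2^-1 by lra.
rewrite (@lnM _ 2 a) ?posrE//.
have l1 : ln (a + th) <= ln a + a^-1.
  apply: le_trans (lnD_le a0 _) _; first lra.
  by rewrite lerD2l ler_piMl ?invr_ge0; lra.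
have l2 : ln (a + th + 2^-1) <= ln a + a^-1.
  rewrite -addrA; apply: le_trans (lnD_le a0 _) _; first lra.
  by rewrite lerD2l ler_piMl ?invr_ge0; lra.
have l3 : ln a <= ln (a + 2^-1) by rewrite ler_ln ?posrE; lra.
have a1' : 0 <= a^-1 by rewrite invr_ge0; lra.
have : (1 - th) * ln (a + th) <= (1 - th) * (ln a + a^-1).
  by rewrite ler_wpM2l; lra.
have : (1 - th) * ln (a + th + 2^-1) <= (1 - th) * (ln a + a^-1).
  by rewrite ler_wpM2l; lra.
have : 0 <= th * a^-1 by rewrite mulr_ge0.
lra.
Qed.

(** By periodicity the error 2 / a may be replaced by 2 / (a + n), hence
    dropped; a longer move is a sequence of moves by at most 1/2. *)
Let defect_antitone a y : 1 <= a -> a <= y -> defect y <= defect a.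
Proof.
have half b th : 1 <= b -> 0 <= th <= 2^-1 -> defect (b + th) <= defect b.
  move=> b1 th01; apply: (@le_of_le_addV _ _ 2 b) => n.
  rewrite -(defect_periodic n b1) -(@defect_periodic (b + th) n); last by lra.
  rewrite addrAC; apply: defect_shift_le => //.
  by rewrite ler_wpDr.
have steps n : forall b z, 1 <= b -> b <= z <= b + n%:R / 2 ->
    defect z <= defect b.
  elim: n => [|n ih] b z b1 /andP[bz zn].
    have -> : z = b by lra.
    by [].
  have [zb|zb] := leP z (b + 2^-1).
    have -> : z = b + (z - b) by lra.
    apply: half => //; lra.
  apply: (@le_trans _ _ (defect (b + 2^-1))); last by apply: half => //; lra.
  apply: ih; first lra.
  rewrite -natr1 in zn; lra.
move=> a1 ay; apply: (steps (2 * Num.bound (y - a))%N) => //.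
rewrite ay/= natrM mulrAC divff// mul1r.
have : y - a < (Num.bound (y - a))%:R by apply: archi_boundP; lra.
lra.
Qed.

(** Legendre's duplication formula, proved as in the Bohr-Mollerup theorem: a
    periodic antitone defect is constant, and it vanishes at 1 because
    Gamma (3/2) = sqrt pi / 2. *)
Lemma ln_Gamma_duplication a : 1 <= a ->
  ln_Gamma (2 * a) = ln_Gamma a + ln_Gamma (a + 2^-1) +
  (2 * a - 1) * ln 2 - 2^-1 * ln pi.
Proof.
move=> a1.
have p1 : defect 1 = 0.
  rewrite /defect mulr1.
  have -> : 1 + 2^-1 = 3 / 2 :> R by lra.
  have -> : 2 = 1 + 1 :> R by lra.
  rewrite ln_GammaS// !ln_GammaE Gamma1 ln1 Gamma_3half.
  rewrite ln_div ?posrE ?sqrtr_gt0 ?pi_gt0//.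
  rewrite -powR12_sqrt ?pi_ge0// ln_powR.
  have -> : 1 + 1 = 2 :> R by lra.
  lra.
have pa : defect a <= 0 by rewrite -p1; apply: defect_antitone.
have ap : 0 <= defect a.
  rewrite -p1 -(defect_periodic (Num.bound a) (lexx 1)).
  apply: defect_antitone => //.
  have : a < (Num.bound a)%:R by apply: archi_boundP; lra.
  lra.
by move: pa ap; rewrite /defect; lra.
Qed.

End duplication.

(** * The maximum of the density ratio *)

Section maximum.
Set Implicit Arguments.
Unset Strict Implicit.
Context {R : realType}.
Implicit Types (a b s x y d : R).

Lemma sup_is_max (A : set R) (m : R) : is_max A m -> sup A = m.
Proof.
move=> [Am ubm]; apply/le_anti/andP; split.
  by apply: ge_sup; [exists m|].
by apply: ub_le_sup => //; exists m.
Qed.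

(** As (x - 1/2)^2 = 1/4 - x (1 - x), the density ratio depends on x only
    through y = x (1 - x), and its logarithm is concave in y. *)
Definition log_ratio a s y :=
  ln_Gamma (2 * a) - 2 * ln_Gamma a + 2^-1 * (ln 2 + ln pi + ln (s ^+ 2)) +
  (a - 1) * ln y + (4^-1 - y) / (2 * s ^+ 2).

Lemma beta_normal_ratioE a s x : 1 < a -> 0 < s -> 0 < x < 1 ->
  beta_normal_ratio a s x = expR (log_ratio a s (x * (1 - x))).
Proof.
move=> a1 s0 /andP[x0 x1].
have y0 : 0 < 1 - x by lra.
have s20 : 0 < s ^+ 2 by rewrite exprn_gt0.
have G2 : expR (ln_Gamma (2 * a)) = Gamma (2 * a).
  by rewrite ln_GammaE lnK// posrE Gamma_gt0//; lra.
have G1 : expR (ln_Gamma a) = Gamma a.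
  by rewrite ln_GammaE lnK// posrE Gamma_gt0//; lra.
have sE : expR (2^-1 * (ln 2 + ln pi + ln (s ^+ 2))) =
    Num.sqrt (s ^+ 2 * pi *+ 2).
  have p0 : 0 < s ^+ 2 * pi *+ 2 :> R.
    by rewrite pmulrn_lgt0// mulr_gt0// pi_gt0.
  rewrite -powR12_sqrt ?ltW// /powR gt_eqF//; congr (expR (_ * _)).
  rewrite -mulr_natr -!lnM ?posrE ?mulr_gt0 ?pi_gt0//.
  by congr ln; ring.
rewrite /beta_normal_ratio /sym_beta_pdf normal_pdfE ?gt_eqF//.
rewrite /normal_peak /normal_fun -sE.
rewrite /powR !gt_eqF// -G1 -G2 -!expRN -expRM_natl -!expRD.
rewrite -expRN -!expRD -expRN -expRD; congr expR.
rewrite /log_ratio lnM ?posrE// -mulr_natr.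
by field; rewrite gt_eqF.
Qed.

(** The critical point of the log-ratio in y, cut off at the largest value
    1/4 of x (1 - x). *)
Definition max_arg a s := Num.min 4^-1 (2 * s ^+ 2 * (a - 1)).

Lemma max_arg_itv a s : 1 < a -> 0 < s -> 0 < max_arg a s <= 4^-1.
Proof.
move=> a1 s0; rewrite /max_arg ge_min lexx/= andbT lt_min invr_gt0 ltr0n/=.
by rewrite mulr_gt0 ?subr_gt0// mulr_gt0// exprn_gt0.
Qed.

(** Concavity: the tangent of ln at the maximiser m reduces the claim to a
    linear one, whose slope (a - 1) / m - 1 / (2 s^2) is 0 if m is the critical
    point, and nonnegative if m = 1/4, in which case y <= m. *)
Lemma log_ratio_le a s y : 1 < a -> 0 < s -> 0 < y <= 4^-1 ->
  log_ratio a s y <= log_ratio a s (max_arg a s).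
Proof.
move=> a1 s0 /andP[y0 y4]; have /andP[m0 m4] := max_arg_itv a1 s0.
have s20 : 0 < s ^+ 2 by rewrite exprn_gt0.
set m := max_arg a s in m0 m4 *.
have lny : ln y - ln m <= y / m - 1.
  by have := ln_le_sub1 (divr_gt0 y0 m0); rewrite ln_div ?posrE.
have : (a - 1) * (ln y - ln m) <= (a - 1) * (y / m - 1).
  by rewrite ler_wpM2l//; lra.
have slope : (a - 1) * (y / m - 1) <= (y - m) / (2 * s ^+ 2).
  have -> : (a - 1) * (y / m - 1) = (y - m) * ((a - 1) / m).
    by field; rewrite gt_eqF.
  have [h|h] := leP 4^-1 (2 * s ^+ 2 * (a - 1)).
    have mE : m = 4^-1 by rewrite /m /max_arg; apply/min_idPl.
    rewrite ler_wnM2l//; first by lra.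
    rewrite ler_pdivlMr// ler_pdivrMl// ?mulr_gt0//; lra.
  have mE : m = 2 * s ^+ 2 * (a - 1) by rewrite /m /max_arg; apply/min_idPr/ltW.
  rewrite le_eqVlt; apply/orP; left; apply/eqP; congr (_ * _).
  by rewrite mE; field; rewrite !gt_eqF//; lra.
rewrite /log_ratio.
have dE : (y - m) / (2 * s ^+ 2) =
    (4^-1 - m) / (2 * s ^+ 2) - (4^-1 - y) / (2 * s ^+ 2).
  by rewrite -mulrBl; congr (_ * _); lra.
move: slope; rewrite dE; set v := (4^-1 - m) / _; set w := (4^-1 - y) / _.
lra.
Qed.

(** The maximum is attained at x = 1/2 + sqrt (1/4 - m), where m is the
    maximiser in y. *)
Lemma is_max_beta_normal a s : 1 < a -> 0 < s ->
  is_max [set beta_normal_ratio a s x | x in `]0, 1[]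
    (expR (log_ratio a s (max_arg a s))).
Proof.
move=> a1 s0; have /andP[m0 m4] := max_arg_itv a1 s0.
split.
  pose r := Num.sqrt (4^-1 - max_arg a s).
  have r2 : r ^+ 2 = 4^-1 - max_arg a s by rewrite sqr_sqrtr//; lra.
  have r0 : 0 <= r by rewrite sqrtr_ge0.
  have r1 : r < 2^-1 by rewrite -(@ltr_pXn2r _ 2) ?nnegrE// r2; lra.
  exists (2^-1 + r); first by rewrite /= in_itv/=; lra.
  rewrite beta_normal_ratioE//; last by lra.
  congr (expR (log_ratio a s _)).
  rewrite expr2 in r2; lra.
move=> z [x]; rewrite /= in_itv/= => x01 <- {z}.
rewrite beta_normal_ratioE// ler_expR; apply: log_ratio_le => //.
case/andP: x01 => x0 x1.
rewrite mulr_gt0/= ?subr_gt0//.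
have : 0 <= (x - 2^-1) ^+ 2 by rewrite sqr_ge0.
rewrite expr2; lra.
Qed.

Lemma max_ratioE a s : 1 < a -> 0 < s ->
  max_ratio a s = expR (log_ratio a s (max_arg a s)).
Proof. by move=> a1 s0; apply/sup_is_max/is_max_beta_normal. Qed.

(** The closed form of the logarithm of the maximum at the given standard
    deviation, after Legendre's duplication has removed Gamma (2a). *)
Definition log_max d a :=
  ln_Gamma (a + 2^-1) - ln_Gamma a + (a - 1) * ln (a - 1) -
  (a - 2^-1) * ln (a + d) + 1 + d.

(** Here the critical point is (a - 1) / (4 (a + d)), which is at most 1/4
    exactly when d >= -1, so that the cut-off never takes effect. *)
Lemma log_max_ratioE d a : -1 <= d -> 1 < a -> log_max_ratio d a = log_max d a.
Proof.
move=> d1 a1; have b0 : 0 < a + d by lra.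
have s0 : 0 < sigma_of d a by rewrite powR_gt0//; lra.
have s2 : sigma_of d a ^+ 2 = (8 * (a + d))^-1.
  rewrite /sigma_of -powR_mulrn ?powR_ge0// -powRrM mulNr mulVf//.
  by rewrite powR_inv1//; lra.
rewrite /log_max_ratio max_ratioE// expRK.
have -> : max_arg a (sigma_of d a) = (a - 1) / (4 * (a + d)).
  rewrite /max_arg s2.
  have -> : 2 * (8 * (a + d))^-1 * (a - 1) = (a - 1) / (4 * (a + d)).
    by field; rewrite gt_eqF.
  by apply/min_idPr; rewrite ler_pdivrMr; lra.
rewrite /log_ratio s2 ln_Gamma_duplication; last lra.
rewrite lnV ?ln_div ?posrE; [|lra..].
rewrite !lnM ?posrE; [|lra..].
have -> :
    (4^-1 - (a - 1) / (4 * (a + d))) / (2 * (8 * (a + d))^-1) = 1 + d.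
  by field; rewrite gt_eqF.
have -> : 8 = 2 ^+ 3 :> R by rewrite -natrX.
have -> : 4 = 2 ^+ 2 :> R by rewrite -natrX.
rewrite !lnXn// /log_max; lra.
Qed.

End maximum.

(** * Expansion at infinity *)

Section asymptotics.
Set Implicit Arguments.
Unset Strict Implicit.
Context {R : realType}.
Implicit Types (a b s x y d : R).

(** The derivative of ln (1 + y) - y + y^2/2 is y^2 / (1 + y), at most
    2 y^2 in absolute value for |y| <= 1/2; conclude by the mean value
    theorem. *)
Lemma ln1D_taylor2 x : `|x| <= 2^-1 ->
  `|ln (1 + x) - x + x ^+ 2 / 2| <= 2 * `|x| ^+ 3.
Proof.
move=> x2.
pose h y := ln (1 + y) - y + y ^+ 2 / 2.
have h0 : h 0 = 0 by rewrite /h addr0 ln1 expr0n/= mul0r; lra.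
have dh y : - 2^-1 <= y -> is_derive y 1 h (y ^+ 2 / (1 + y)).
  move=> y2; have y1 : 0 < 1 + y by lra.
  have dl := is_derive1_ln y1.
  have dln : is_derive y 1 (fun z => ln (1 + z)) _ :=
    @is_derive1_comp _ _ (fun z => 1 + z) _ _ _ dl _.
  rewrite /h; apply: is_derive_eq.
  rewrite /GRing.scale/=; field; rewrite gt_eqF//.
have bound c b1 b2 : `|c| <= `|x| ->
    h b2 - h b1 = c ^+ 2 / (1 + c) * (b2 - b1) ->
    `|b2 - b1| = `|x| -> `|h b2 - h b1| <= 2 * `|x| ^+ 3.
  move=> cx -> bx; rewrite !normrM bx exprSr mulrA ler_wpM2r//.
  have c1 : 2^-1 <= 1 + c by have := ler_norm (- c); rewrite normrN; lra.
  rewrite normfV (ger0_norm (_ : 0 <= 1 + c)); last lra.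
  rewrite ler_pdivrMr; last lra.
  rewrite -expr2.
  have : `|c| ^+ 2 <= `|x| ^+ 2 by rewrite lerXn2r ?nnegrE.
  have : 0 <= `|x| ^+ 2 by rewrite exprn_ge0.
  set u := `|x| ^+ 2; move=> u0 ?.
  have : u * 1 <= u * (2 * (1 + c)) by rewrite ler_wpM2l//; lra.
  lra.
rewrite -/(h x) -[h x]subr0 -h0.
have cont b1 b2 : - 2^-1 <= b1 -> {within `[b1, b2], continuous h}.
  move=> hb; apply: derivable_within_continuous => y.
  rewrite in_itv/= => /andP[y1 _].
  by have [] := dh y (le_trans hb y1).
have mvt b1 b2 : - 2^-1 <= b1 -> b1 <= b2 ->
    exists2 c, b1 <= c <= b2 & h b2 - h b1 = c ^+ 2 / (1 + c) * (b2 - b1).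
  move=> hb b12.
  have [y yi||c] := @MVT_segment _ h (fun y => y ^+ 2 / (1 + y)) b1 b2 b12.
  - by apply: dh; move: yi; rewrite in_itv/=; lra.
  - exact: cont.
  - by rewrite in_itv/= => ? ?; exists c.
have [x0|x0] := leP 0 x.
  rewrite ger0_norm// in x2.
  have [c /andP[c0 cx] hE] := mvt 0 x ltac:(lra) x0.
  by apply: bound hE _; rewrite ?subr0// !ger0_norm.
rewrite ltr0_norm// in x2.
have [c /andP[cx c0] hE] := mvt x 0 ltac:(lra) (ltW x0).
rewrite distrC; apply: bound hE _; last by rewrite sub0r normrN.
by rewrite (ler0_norm c0) (ltr0_norm x0) lerN2.
Qed.

(** The form in which limits at infinity are used: a decreasing sequence
    bounded below by a null sequence is nonnegative. *)
Lemma ge0_of_antitone (u : nat -> R) (c x : R) :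
  (forall n, u n.+1 <= u n) -> (forall n, - (c / (x + n%:R)) <= u n) ->
  0 <= u 0%N.
Proof.
move=> uS ub; apply: (@le_of_le_addV _ _ _ c x) => n.
have : u n <= u 0%N by elim: n => // n; apply: le_trans.
by have := ub n; lra.
Qed.

(** The error of the expansion ln (a) / 2 - 1 / (8a) of the increment of
    ln Gamma over a half step. *)
Let half_step_error a :=
  ln_Gamma (a + 2^-1) - ln_Gamma a - 2^-1 * ln a + 1 / (8 * a).

Let half_step_error_le a : 1 <= a -> `|half_step_error a| <= a^-1.
Proof.
move=> a1; have a0 : 0 < a by lra.
have ia0 : 0 < a^-1 by rewrite invr_gt0.
have := @ln_Gamma_le R a 2^-1 a1 ltac:(lra).
have := @ln_Gamma_ge R a 2^-1 a1 ltac:(lra).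
have := @lnD_le R a 2^-1 a0 ltac:(lra).
have -> : half_step_error a =
    ln_Gamma (a + 2^-1) - ln_Gamma a - 2^-1 * ln a + 8^-1 * a^-1.
  by rewrite /half_step_error; congr (_ + _); field; rewrite gt_eqF.
by rewrite ler_norml; lra.
Qed.

(** By the recursion the difference is elementary, and second-order expansion
    of both logarithms cancels the terms in 1/a and 1/a^2. *)
Let half_step_error_step a : 2 <= a ->
  `|half_step_error a - half_step_error (a + 1)| <= 2 * a ^- 3.
Proof.
move=> a2; have a0 : 0 < a by lra.
have ia0 : 0 < a^-1 by rewrite invr_gt0.
have ia2 : a^-1 <= 2^-1 by rewrite lef_pV2 ?posrE//; lra.
set i := a^-1 in ia0 ia2.
have := @ln1D_taylor2 i; rewrite (gtr0_norm ia0) => /(_ ia2).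
have i2 : 0 < i / 2 by lra.
have := @ln1D_taylor2 (i / 2); rewrite (gtr0_norm i2) => /(_ ltac:(lra)).
have e1 : ln (1 + i) = ln (a + 1) - ln a.
  by rewrite -ln_div ?posrE//; [|lra];
    congr ln; rewrite /i; field; rewrite gt_eqF.
have e2 : ln (1 + i / 2) = ln (a + 2^-1) - ln a.
  by rewrite -ln_div ?posrE//; [|lra];
    congr ln; rewrite /i; field; rewrite gt_eqF.
have e3 : 1 / (8 * a) - 1 / (8 * (a + 1)) = 8^-1 * (i / (a + 1)).
  by rewrite /i; field; rewrite !gt_eqF; lra.
have e4 : i ^+ 2 - i ^+ 3 <= i / (a + 1) <= i ^+ 2.
  have -> : i / (a + 1) = i ^+ 2 - i ^+ 2 / (a + 1).
    by rewrite /i; field; rewrite !gt_eqF; lra.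
  have : 0 <= i ^+ 2 / (a + 1) by rewrite divr_ge0 ?sqr_ge0//; lra.
  have : i ^+ 2 / (a + 1) <= i ^+ 2 * i.
    rewrite ler_wpM2l ?sqr_ge0// lef_pV2 ?posrE//; lra.
  by rewrite -exprSr; lra.
have i3 : 0 < i ^+ 3 by rewrite exprn_gt0.
have -> : a ^- 3 = i ^+ 3 by rewrite exprVn.
have -> : half_step_error a - half_step_error (a + 1) =
    - (ln (1 + i / 2)) + 2^-1 * ln (1 + i) + 8^-1 * (i / (a + 1)).
  have gS1 := @ln_GammaS R a ltac:(lra).
  have gS2 := @ln_GammaS R (a + 2^-1) ltac:(lra).
  have aE : a + 2^-1 + 1 = a + 1 + 2^-1 by lra.
  rewrite /half_step_error -aE gS1 gS2 -e3 e1 e2; lra.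
rewrite !ler_norml.
have -> : (i / 2) ^+ 2 = i ^+ 2 / 4 by field.
have -> : (i / 2) ^+ 3 = i ^+ 3 / 8 by field.
move: e4; set w := i / (a + 1); set l1 := ln (1 + i).
by set l2 := ln (1 + i / 2); lra.
Qed.

(** As a^-3 <= a^-2 - (a + 1)^-2 for a >= 2, the functions 2 a^-2 - e g with
    e = 1 and e = -1, where g is the error, decrease along unit steps. They
    tend to 0, so they are nonnegative. *)
Let half_step_error_bound a : 2 <= a -> `|half_step_error a| <= 2 * a ^- 2.
Proof.
move=> a2.
have drop x : 2 <= x -> x ^- 3 <= x ^- 2 - (x + 1) ^- 2.
  move=> x2; have x0 : 0 < x by lra.
  have -> : x ^- 2 - (x + 1) ^- 2 = x ^- 3 * (x * (2 * x + 1) / (x + 1) ^+ 2).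
    by field; rewrite !gt_eqF; lra.
  apply: ler_peMr; first by rewrite invr_ge0 exprn_ge0// ltW.
  rewrite ler_pdivlMr ?exprn_gt0//; last lra.
  by nra.
have bnd e : `|e| <= 1 -> 0 <= 2 * a ^- 2 - e * half_step_error a.
  move=> e1; pose u n := 2 * (a + n%:R) ^- 2 - e * half_step_error (a + n%:R).
  have := @ge0_of_antitone u 1 a; rewrite /u addr0; apply => n.
    have an2 : 2 <= a + n%:R by rewrite ler_wpDr.
    have := half_step_error_step an2; have := drop _ an2.
    rewrite -(natr1 n) addrA; set x := a + n%:R => dx gx.
    have : `|e * (half_step_error x - half_step_error (x + 1))|
        <= 1 * `|half_step_error x - half_step_error (x + 1)|.
      by rewrite normrM ler_wpM2r.
    by rewrite ler_norml; lra.
  have an1 : 1 <= a + n%:R by rewrite ler_wpDr//; lra.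
  have := half_step_error_le an1; set x := a + n%:R => gx.
  have : `|e * half_step_error x| <= 1 * `|half_step_error x|.
    by rewrite normrM ler_wpM2r.
  have : 0 <= x ^- 2 by rewrite invr_ge0 sqr_ge0.
  by rewrite ler_norml; lra.
have := bnd 1; rewrite normr1 => /(_ (lexx 1)).
have := bnd (- 1); rewrite normrN1 => /(_ (lexx 1)).
by rewrite ler_norml; lra.
Qed.

(** Besides the half-step error, the closed form contains
    (a - 1) ln (1 - 1/a) and (a - 1/2) ln (1 + d/a), whose second-order
    expansions leave errors of order a^-2. The coefficient of 1/a is
    - 1/8 + 1/2 + (d^2 + d) / 2. *)
Lemma log_max_asymptotics d a : 2 * `|d| + 2 <= a ->
  `|log_max d a - (d * (d + 1) + 3 / 4) / (2 * a)|
    <= (5 + `|d| ^+ 2 + 2 * `|d| ^+ 3) * a ^- 2.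
Proof.
move=> da; have d0 := normr_ge0 d; have a2 : 2 <= a by lra.
have a0 : 0 < a by lra.
have := half_step_error_bound a2.
have ia0 : 0 < a^-1 by rewrite invr_gt0.
have ia2 : a^-1 <= 2^-1 by rewrite lef_pV2 ?posrE//; lra.
have dai : `|d * a^-1| <= 2^-1.
  by rewrite normrM (gtr0_norm ia0) ler_pdivrMr//; lra.
have ai1 : a * a^-1 = 1 by rewrite divff// gt_eqF.
have L1 := @ln1D_taylor2 (- a^-1).
rewrite normrN (gtr0_norm ia0) in L1; move/(_ ia2) in L1.
have L2 := @ln1D_taylor2 (d * a^-1) dai.
have e1 : ln (1 + - a^-1) = ln (a - 1) - ln a.
  by rewrite -ln_div ?posrE//; [congr ln; field; rewrite gt_eqF|lra].
have e2 : ln (1 + d * a^-1) = ln (a + d) - ln a.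
  have : 0 < a + d by have := ler_norm (- d); rewrite normrN; lra.
  move=> ad0; rewrite -ln_div ?posrE//; congr ln; field; rewrite gt_eqF//.
set i := a^-1 in ia0 ia2 dai ai1 L1 L2 e1 e2.
rewrite -exprVn -/i.
set r1 := _ + (- i) ^+ 2 / 2 in L1.
set r2 := _ + (d * i) ^+ 2 / 2 in L2.
have -> : log_max d a - (d * (d + 1) + 3 / 4) / (2 * a) =
  half_step_error a + ((a - 1) * r1 + i ^+ 2 / 2)
  - ((a - 2^-1) * r2 + (d * i) ^+ 2 / 4).
  rewrite /log_max /half_step_error /r1 /r2 e1 e2 /i; field; rewrite gt_eqF//.
have ai2 : a * i ^+ 3 = i ^+ 2 by rewrite exprSr mulrCA ai1 mulr1.
have weighted b K r : 0 <= b <= a -> 0 <= K -> `|r| <= K * i ^+ 3 ->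
    `|b * r| <= K * i ^+ 2.
  move=> /andP[b0 ba] K0 rK; rewrite normrM (ger0_norm b0) -ai2 mulrCA.
  by apply: ler_pM.
have a1i : `|(a - 1) * r1| <= 2 * i ^+ 2 by apply: weighted => //; lra.
have a2i : `|(a - 2^-1) * r2| <= 2 * `|d| ^+ 3 * i ^+ 2.
  apply: weighted; first lra.
    by rewrite mulr_ge0 ?exprn_ge0.
  by move: L2; rewrite normrM exprMn (gtr0_norm ia0) mulrA.
move=> gb.
have -> : (d * i) ^+ 2 = `|d| ^+ 2 * i ^+ 2.
  by rewrite exprMn real_normK ?num_real.
have di0 : 0 <= `|d| ^+ 2 * i ^+ 2 by rewrite mulr_ge0 ?exprn_ge0// ltW.
have i20 : 0 <= i ^+ 2 by rewrite exprn_ge0// ltW.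
move: gb a1i a2i di0; rewrite !ler_norml.
by set w1 := (a - 1) * r1; set w2 := (a - 2^-1) * r2; lra.
Qed.

End asymptotics.

(** * Strict decrease *)

Section monotonicity.
Set Implicit Arguments.
Unset Strict Implicit.
Context {R : realType}.
Implicit Types (a b s x y d : R).

(** The decrease of the closed form over a unit step; the recursion of Gamma
    makes it elementary. *)
Definition log_max_drop d a :=
  (a - 1) * ln (a - 1) - (a - 1) * ln a - ln (a + 2^-1)
  - (a - 2^-1) * ln (a + d) + (a + 2^-1) * ln (a + (d + 1)).

Lemma log_max_dropE d a : 1 <= a ->
  log_max d a - log_max d (a + 1) = log_max_drop d a.
Proof.
move=> a1; rewrite /log_max /log_max_drop.
have gS1 := @ln_GammaS R a a1.
have gS2 := @ln_GammaS R (a + 2^-1) ltac:(lra).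
have -> : a + 1 + 2^-1 = a + 2^-1 + 1 by lra.
have -> : a + 1 - 1 = a by lra.
have -> : a + 1 + d = a + (d + 1) by lra.
rewrite gS1 gS2; lra.
Qed.

Definition log_max_drop' d a :=
  ln (a - 1) - ln a + a^-1 - (a + 2^-1)^-1
  + ln (a + (d + 1)) - ln (a + d)
  + (a + 2^-1) / (a + (d + 1)) - (a - 2^-1) / (a + d).

Lemma is_derive_log_max_drop d a : -1 <= d -> 1 < a ->
  is_derive a 1 (log_max_drop d) (log_max_drop' d a).
Proof.
move=> d1 a1.
have lnD c : 0 < a + c -> is_derive a 1 (fun x => ln (x + c)) (a + c)^-1.
  move=> ac0; have dl := is_derive1_ln ac0.
  apply: (is_derive_eq (@is_derive1_comp _ _ (fun x => x + c) _ _ _ dl _)).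
  by rewrite addr0 mulr1.
have h1 := lnD (- 1) ltac:(lra).
have h2 : is_derive a 1 (@ln R) a^-1 by apply: is_derive1_ln; lra.
have h3 := lnD 2^-1 ltac:(lra).
have h4 := lnD d ltac:(lra).
have h5 := lnD (d + 1) ltac:(lra).
rewrite /log_max_drop; apply: is_derive_eq.
rewrite /GRing.scale/= /log_max_drop'; field.
by rewrite !gt_eqF; lra.
Qed.

(** With b = a + d, the terms of the derivative that contain b are largest at
    b = a - 1/2. There they reduce to a difference of two logarithms, and the
    sum is bounded through ln u <= u - 1 by a negative rational function. *)
Lemma log_max_drop'_lt0 d a : -1 <= d -> 1 < a -> log_max_drop' d a < 0.
Proof.
move=> d1 a1; pose b := a + d; have b0 : 0 < b by rewrite /b; lra.
have ah0 : 0 < a - 2^-1 by lra.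
(* Both inequalities come from ln u <= u - 1: here at u = y, with a square as
   the gap, and below at u = z. *)
have worst : ln (b + 1) - ln b + (a + 2^-1) / (b + 1) - (a - 2^-1) / b <=
    ln (a + 2^-1) - ln (a - 2^-1).
  pose y := ((b + 1) * (a - 2^-1)) / (b * (a + 2^-1)).
  have y0 : 0 < y by rewrite /y divr_gt0// mulr_gt0//; lra.
  have lny : ln y = ln (b + 1) + ln (a - 2^-1) - (ln b + ln (a + 2^-1)).
    by rewrite /y ln_div ?lnM ?posrE// ?mulr_gt0//; lra.
  have := ln_le_sub1 y0; rewrite lny.
  have tE : (a + 2^-1) / (b + 1) - (a - 2^-1) / b =
      - (y - 1) - (b - (a - 2^-1)) ^+ 2 / (b * (b + 1) * (a + 2^-1)).
    by rewrite /y; field; rewrite !gt_eqF; lra.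
  have : 0 <= (b - (a - 2^-1)) ^+ 2 / (b * (b + 1) * (a + 2^-1)).
    by rewrite divr_ge0 ?sqr_ge0// !mulr_ge0; lra.
  move: tE; set u := _ / (b * (b + 1) * _).
  set v := _ / (b + 1); set w := _ / b; lra.
pose z := ((a - 1) * (a + 2^-1)) / (a * (a - 2^-1)).
have z0 : 0 < z by rewrite /z divr_gt0// mulr_gt0//; lra.
have lnz : ln z = ln (a - 1) + ln (a + 2^-1) - (ln a + ln (a - 2^-1)).
  by rewrite /z ln_div ?lnM ?posrE// ?mulr_gt0//; lra.
have := ln_le_sub1 z0; rewrite lnz.
have : z - 1 + (a^-1 - (a + 2^-1)^-1) < 0.
  have -> : z - 1 + (a^-1 - (a + 2^-1)^-1) =
      - (2 * a * (a - 2^-1) * (a + 2^-1))^-1.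
    by rewrite /z; field; rewrite !gt_eqF; lra.
  by rewrite oppr_lt0 invr_gt0 !mulr_gt0//; lra.
have -> : log_max_drop' d a = ln (a - 1) - ln a + (a^-1 - (a + 2^-1)^-1) +
    (ln (b + 1) - ln b + (a + 2^-1) / (b + 1) - (a - 2^-1) / b).
  by rewrite /log_max_drop' addrA -/b; lra.
move: worst; set v := _ / (b + 1); set w := _ / b; lra.
Qed.

Lemma log_max_drop_decreasing d a b : -1 <= d -> 1 < a -> a < b ->
  log_max_drop d b < log_max_drop d a.
Proof.
move=> d1 a1 ab.
have [x xab||c] := @MVT _ (log_max_drop d) (log_max_drop' d) a b ab.
- by apply: is_derive_log_max_drop => //; move: xab; rewrite in_itv/=; lra.
- apply: derivable_within_continuous => x; rewrite in_itv/= => xab.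
  by have [] := @is_derive_log_max_drop d x d1 ltac:(lra).
rewrite in_itv/= => cab E.
have := @log_max_drop'_lt0 d c d1 ltac:(lra).
rewrite -(pmulr_llt0 (x := b - a)) -?E; lra.
Qed.

(** The gap between the values at a + n and b + n decreases strictly with n,
    because the unit-step drop is strictly decreasing, and it tends to 0 by the
    asymptotics. So the gap at n = 0 is positive. *)
Lemma log_max_decreasing d a b : -1 <= d -> 1 < a -> a < b ->
  log_max d b < log_max d a.
Proof.
move=> d1 a1 ab.
pose D x := log_max d (a + x) - log_max d (b + x).
have DS x : 0 <= x -> D (x + 1) < D x.
  move=> x0; have :=
    @log_max_drop_decreasing d (a + x) (b + x) d1 ltac:(lra) ltac:(lra).
  rewrite -!log_max_dropE; try lra.
  by rewrite /D !addrA; lra.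
(* The expansion holds from N on, so D 1 is compared with D (1 + N + n). The
   strict inequality comes from the first step, from D 0 to D 1. *)
pose N : nat := Num.bound (2 * `|d| + 2).
have Nd : 2 * `|d| + 2 < N%:R.
  by apply: archi_boundP; have := normr_ge0 d; lra.
have [K Kb] : exists K, forall x, N%:R <= x -> `|log_max d x| <= K / x.
  pose c := d * (d + 1) + 3 / 4; pose C := 5 + `|d| ^+ 2 + 2 * `|d| ^+ 3.
  have C0 : 0 <= C by rewrite /C !addr_ge0 ?mulr_ge0 ?exprn_ge0.
  exists (`|c| + C) => x xN.
  have x2 : 2 * `|d| + 2 <= x by lra.
  have x1 : 1 <= x by have := normr_ge0 d; lra.
  have x0 : 0 < x by lra.
  have := log_max_asymptotics x2; rewrite -/c -/C => h.
  have Cx : C * x ^- 2 <= C * x^-1.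
    by rewrite ler_wpM2l// lef_pV2 ?posrE ?exprn_gt0// ler_eXnr.
  have cx : `|c / (2 * x)| <= `|c| * x^-1.
    rewrite normrM normfV ler_wpM2l// (ger0_norm (_ : 0 <= 2 * x)); last lra.
    by rewrite lef_pV2 ?posrE; lra.
  by move: h cx; rewrite !ler_norml (mulrDl _ C); set q := c / (2 * x); lra.
suff D1 : 0 <= D 1.
  have := DS 0 (lexx 0); rewrite add0r => /(le_lt_trans D1).
  by rewrite /D !addr0 subr_gt0.
have DN n : D (1 + n%:R) <= D 1.
  elim: n => [|n ih]; first by rewrite addr0.
  apply: le_trans ih; rewrite -(natr1 n) addrA ltW// DS// addr_ge0.
apply: (@le_of_le_addV _ _ _ (2 * K) (a + 1 + N%:R)) => n.
have := DN (N + n)%N; rewrite natrD /D.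
set x := a + (1 + _); set y := b + (1 + _).
have n0 : 0 <= n%:R :> R by [].
have N0 : 0 <= N%:R :> R by [].
have Kx := Kb x ltac:(rewrite /x; lra).
have Ky := Kb y ltac:(rewrite /y; lra).
have x0 : 0 < x by rewrite /x; lra.
have xy : x < y by rewrite /x /y; lra.
have K0 : 0 <= K.
  have : 0 <= K / x by apply: le_trans Kx.
  by rewrite pmulr_lge0// invr_gt0.
have : K / y <= K / x by rewrite ler_wpM2l// lef_pV2 ?posrE; lra.
have -> : a + 1 + N%:R + n%:R = x by rewrite /x !addrA.
have -> : 2 * K / x = 2 * (K / x) by rewrite mulrA.
by move: Kx Ky; rewrite !ler_norml; lra.
Qed.

End monotonicity.

Theorem lemma5p1 (R : realType) :
  (forall a sigma : R, 1 < a -> 0 < sigma ->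
     is_max [set beta_normal_ratio a sigma x | x in `]0, 1[]
            (max_ratio a sigma)) /\
  (forall delta : R, -1 <= delta ->
     (forall a b : R, 1 < a -> a < b ->
        log_max_ratio delta b < log_max_ratio delta a) /\
     (fun a : R => log_max_ratio delta a
                   - (delta * (delta + 1) + 3 / 4) / (2 * a))
       =O_+oo (fun a : R => a ^- 2)).
Proof.
split=> [a s a1 s0|d d1].
  by rewrite max_ratioE//; exact: is_max_beta_normal.
split=> [a b a1 ab|].
  have b1 := lt_trans a1 ab.
  by rewrite !log_max_ratioE//; exact: log_max_decreasing.
apply/eqO_exP; exists (5 + `|d| ^+ 2 + 2 * `|d| ^+ 3).
  by rewrite -addrA ltr_wpDr// addr_ge0 ?mulr_ge0 ?exprn_ge0.
near=> a.
have da : 2 * `|d| + 2 <= a.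
  by near: a; apply: nbhs_pinfty_ge; exact: num_real.
have a2 : 2 <= a by have := normr_ge0 d; lra.
have a1 : 1 < a by apply: lt_le_trans a2; rewrite ltr1n.
rewrite log_max_ratioE//.
rewrite [`|a ^- 2|]ger0_norm ?invr_ge0 ?sqr_ge0//.
exact: log_max_asymptotics.
Unshelve. all: by end_near.
Qed.
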